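(* Let $G$ be a graph having the Pairing-Hamiltonian property. Then, for each integer $k\geq 0$, the graph $\mathcal{P}^k(G)$ has the Pairing-Hamiltonian property.
   Context: All graphs are finite and simple. For a graph $G$, let $K_G$ denote the complete graph on the vertex set $V(G)$. If $G$ has even order, a perfect matching of $K_G$ is called a pairing of $G$. A pairing $M$ of $G$ can be extended to a Hamiltonian cycle if there exists a perfect matching $N$ of $G$ (using only edges of $G$) such that $M\cup N$ is the edge set of a Hamiltonian cycle of $K_G$. A graph $G$ of even order has the Pairing-Hamiltonian property (PH-property) if every pairing of $G$ can be extended to a Hamiltonian cycle in this sense. The prism graph $\mathcal{P}(G)$ is the Cartesian product $G\,\Box\,K_2$, i.e. two copies of $G$ with an edge joining each vertex to its copy. Define $\mathcal{P}^0(G)=G$ and $\mathcal{P}^k(G)=\mathcal{P}(\mathcal{P}^{k-1}(G))$ for $k\geq 1$. *)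

(* Defs.v *)
From mathcomp Require Import all_boot.
Set Implicit Arguments.
Unset Strict Implicit.
Unset Printing Implicit Defensive.

Record sgraph := SGraph {
  vertex :> finType;
  adj : rel vertex;
  adj_sym : symmetric adj;
  adj_irrefl : irreflexive adj }.

Definition complete_adj (T : finType) : rel T := fun x y => x != y.

Lemma complete_adj_sym (T : finType) : symmetric (@complete_adj T).
Proof. by move=> x y; rewrite /complete_adj eq_sym. Qed.

Lemma complete_adj_irrefl (T : finType) : irreflexive (@complete_adj T).
Proof. by move=> x; rewrite /complete_adj eqxx. Qed.

Definition complete_graph (T : finType) : sgraph :=
  SGraph (@complete_adj_sym T) (@complete_adj_irrefl T).

Definition box_adj (G H : sgraph) : rel (G * H)%type := fun u v =>
  ((u.1 == v.1) && adj u.2 v.2) || ((u.2 == v.2) && adj u.1 v.1).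

Lemma box_adj_sym (G H : sgraph) : symmetric (@box_adj G H).
Proof.
by move=> u v; rewrite /box_adj ![_ == v.1]eq_sym ![_ == v.2]eq_sym
  !(adj_sym _ v.1) !(adj_sym _ v.2).
Qed.

Lemma box_adj_irrefl (G H : sgraph) : irreflexive (@box_adj G H).
Proof. by move=> u; rewrite /box_adj !adj_irrefl !andbF. Qed.

Definition box_prod (G H : sgraph) : sgraph :=
  SGraph (@box_adj_sym G H) (@box_adj_irrefl G H).

Definition prism (G : sgraph) : sgraph := box_prod G (complete_graph bool).

Definition edges (G : sgraph) : {set {set G}} :=
  [set [set p.1; p.2] | p : G * G & adj p.1 p.2].

(* Edges are nonempty, so [partition] says exactly that the members of [M]
   are pairwise disjoint and cover every vertex. *)
Definition perfect_matching (G : sgraph) (M : {set {set G}}) : bool :=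
  (M \subset edges G) && partition M [set: G].

Definition pairing (G : sgraph) (M : {set {set G}}) : bool :=
  @perfect_matching (complete_graph G) M.

(* A cycle has at least three vertices: [ucycle] alone would also accept the
   empty sequence and, as a degenerate 2-cycle, a single edge. *)
Definition hamiltonian_cycle (G : sgraph) (C : {set {set G}}) : Prop :=
  exists c : seq G,
    [/\ 2 < size c, ucycle (@adj G) c, forall x : G, x \in c
      & C = [set [set x; next c x] | x in c]].

Definition extends_to_hamiltonian_cycle (G : sgraph) (M : {set {set G}}) : Prop :=
  exists N : {set {set G}},
    perfect_matching N /\ @hamiltonian_cycle (complete_graph G) (M :|: N).

Definition PH_property (G : sgraph) : Prop :=
  ~~ odd #|G| /\
  forall M : {set {set G}}, pairing M -> extends_to_hamiltonian_cycle M.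

(* Main.v *)
(** Perfect matchings are encoded as fixed-point-free involutions.  Two of them,
    m and n, form a Hamiltonian cycle iff the union of m and n is connected (and
    there are more than two vertices), so only connectivity has to be followed.

    Let m be a pairing of the prism.  If some edges of m cross between the two
    copies of G, let X be the set of their ends in the first copy.  Complete the
    non-crossing edges there by any pairing of X and extend to a Hamiltonian
    cycle; deleting the added edges leaves components meeting X evenly, so X can
    be paired within components by a map r.  Transport r along the crossing
    edges to complete the pairing of the second copy, extend it, and replace
    each added edge by a detour through the first copy.

    If no edge crosses, extend the pairing of the second copy by n and use n in
    the first copy as well.  This closes the second copy into a cycle and the
    first into several cycles; select one n-edge on each of these and replace
    its two copies by the two prism edges at its ends. *)

Require Import Defs.
From mathcomp Require Import all_boot.

Set Implicit Arguments.
Unset Strict Implicit.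
Unset Printing Implicit Defensive.

(** * Pairings of subsets, and unions of two matchings with some edges deleted *)

Section Pairs.
Variable T : finType.
Implicit Types (A U : {set T}) (h : T -> T).

(** Nothing is asked of [h] outside [A], so pairings of complementary sets can be glued by
    [patch_pairs]. *)
Definition pairs h A :=
  {in A, forall x, [/\ h x \in A, h x != x & h (h x) = x]}.

Lemma pairs_even h A : pairs h A -> ~~ odd #|A|.
Proof.
elim: {A}_.+1 {-2}A (ltnSn #|A|) => // k IHk A leAk hA.
have [->|[x Ax]] := set_0Vmem A; first by rewrite cards0.
have [Ahx hx_x hhx] := hA x Ax.
have Ahx' : h x \in A :\ x by rewrite !inE hx_x.
have cA : #|A| = #|A :\ x :\ h x|.+2.
  by rewrite (cardsD1 x) Ax (cardsD1 (h x)) Ahx'.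
rewrite cA /= negbK; apply: IHk => [|y]; first by move: leAk; rewrite cA => /ltnW.
rewrite !inE => /and3P[yhx yx Ay]; have [Ahy hy_y hhy] := hA y Ay.
split=> //; rewrite Ahy andbT; apply/andP; split.
  by apply: contraNneq yx => /(congr1 h); rewrite hhy hhx => ->.
by apply: contraNneq yhx => <-; rewrite hhy.
Qed.

Lemma even_pairs A : ~~ odd #|A| -> exists h, pairs h A.
Proof.
elim: {A}_.+1 {-2}A (ltnSn #|A|) => // k IHk A leAk evA.
have [->|[x Ax]] := set_0Vmem A; first by exists id => y; rewrite inE.
have [A1|[y A1y]] := set_0Vmem (A :\ x).
  by move: evA; rewrite (cardsD1 x) Ax A1 cards0.
have cA : #|A| = #|A :\ x :\ y|.+2 by rewrite (cardsD1 x) Ax (cardsD1 y) A1y.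
have [| |h hA] := IHk (A :\ x :\ y).
- by move: leAk; rewrite cA => /ltnW.
- by move: evA; rewrite cA /= negbK.
move: A1y; rewrite !inE => /andP[yx Ay].
exists [eta h with x |-> y, y |-> x] => z Az /=.
have [->|zx] := eqVneq z x; first by rewrite eqxx (negPf yx).
have [->|zy] := eqVneq z y; first by rewrite eqxx eq_sym yx.
have [] := hA z; first by rewrite !inE zx zy.
by rewrite !inE => /and3P[/negPf-> /negPf-> ->] -> ->.
Qed.

Definition linked (m n : T -> T) : rel T :=
  fun x y => (y == m x) || (y == n x).
Arguments linked m n x y /.

(** The deleted [n]-edges are those to be rerouted through the prism: selected edges of the matching
    if no edge crosses, added edges of the pairing otherwise. *)
Definition cut U (m n : T -> T) : rel T :=
  fun x y => (y == m x) || (x \notin U) && (y == n x).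
Arguments cut U m n x y /.

Lemma linked_sym m n : involutive m -> involutive n -> symmetric (linked m n).
Proof.
by move=> mK nK x y /=; rewrite ![y == _]eq_sym (inv_eq mK) (inv_eq nK).
Qed.

Lemma connect_linkedl m n x : connect (linked m n) x (m x).
Proof. by apply: connect1; rewrite /linked eqxx. Qed.

Lemma connect_linkedr m n x : connect (linked m n) x (n x).
Proof. by apply: connect1; rewrite /linked eqxx orbT. Qed.

Lemma connect_linkedC m n : connect (linked m n) =2 connect (linked n m).
Proof. by apply: eq_connect => x y /=; rewrite orbC. Qed.

Lemma patch_pairs U (q p : T -> T) : pairs q U -> pairs p (~: U) ->
  let h x := if x \in U then q x else p x in
  [/\ involutive h, forall x, h x != x & forall x, (h x \in U) = (x \in U)].
Proof.
move=> qU pU h.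
have hP x : [/\ (h x \in U) = (x \in U), h x != x & h (h x) = x].
  rewrite /h; have [Ux|Ux] := boolP (x \in U).
    by have [-> -> ->] := qU x Ux.
  have := pU x; rewrite inE => /(_ Ux)[]; rewrite inE => pUx -> ppx.
  by rewrite (negPf pUx) ppx.
by split=> x; have [] := hP x.
Qed.

Section Cut.
Variables (m n : T -> T) (U : {set T}).
Hypotheses (mK : involutive m) (m_neq : forall x, m x != x).
Hypotheses (nK : involutive n) (n_neq : forall x, n x != x).
Hypothesis nU : forall x, (n x \in U) = (x \in U).

Lemma cut_connect_sym : connect_sym (cut U m n).
Proof.
apply: sym_connect_sym => x y /=; rewrite [y == m x]eq_sym (inv_eq mK); congr (_ || _).
apply/andP/andP=> -[Ux /eqP->]; by rewrite nU nK eqxx.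
Qed.

(** A component is paired by [m] and its part outside [U] by [n]; both are even, hence so is the
    rest. *)
Lemma cut_component_even x :
  ~~ odd #|[set y in U | connect (cut U m n) x y]|.
Proof.
set A := [set y | connect (cut U m n) x y].
have evA : ~~ odd #|A|.
  apply: (@pairs_even m) => y; rewrite !inE => xy; split=> //.
  by apply: connect_trans xy (connect1 _); rewrite /= eqxx.
have evAU : ~~ odd #|A :\: U|.
  apply: (@pairs_even n) => y; rewrite !inE => /andP[Uy xy]; split=> //.
  by rewrite nU Uy (connect_trans xy) // connect1 //= Uy eqxx orbT.
have -> : [set y in U | connect (cut U m n) x y] = A :&: U.
  by apply/setP=> y; rewrite !inE andbC.
by move: evA; rewrite -(cardsID U A) oddD (negPf evAU) addbF.
Qed.

(** If the cut component of [x] avoided [U], it would have lost no edge, so it would be a whole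
    component of the union and contain [u]. *)
Lemma cut_reach x u : u \in U -> connect (linked m n) x u ->
  exists2 v, v \in U & connect (cut U m n) x v.
Proof.
move=> Uu xu; apply/exists_inP; apply: contraT => /exists_inPn noU.
have /closed_connect : closed (linked m n) [pred y | connect (cut U m n) x y].
  apply: intro_closed; first exact/sym_connect_sym/linked_sym.
  move=> y z /= yz; rewrite !inE => xy; apply: connect_trans (xy) (connect1 _) => /=.
  have -> : y \notin U by apply: contraL xy; exact: noU.
  exact: yz.
by move=> /(_ _ _ xu); rewrite !inE connect0 (negPf (noU u Uu)).
Qed.

End Cut.

Lemma connect_homo (T' : finType) (f : T -> T') (e : rel T) (e' : rel T') :
  (forall x y, e x y -> connect e' (f x) (f y)) ->
  forall x y, connect e x y -> connect e' (f x) (f y).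
Proof.
move=> ee' x _ /connectP[p + ->]; elim: p x => //= y p IHp x /andP[/ee' xy].
by move/IHp; apply: connect_trans.
Qed.

End Pairs.

Arguments linked {T} m n x y /.
Arguments cut {T} U m n x y /.

(** * Hamiltonian cycles as connected unions of two involutions *)

Section Matchings.
Variable T : finType.
Implicit Types m n : T -> T.

Definition matching_of m : {set {set T}} := [set [set x; m x] | x : T].

Lemma set2_inj (x y z : T) : y != x -> [set x; y] = [set x; z] -> y = z.
Proof.
by move=> yx /setP/(_ y); rewrite !inE eqxx orbT (negPf yx) => /esym/eqP.
Qed.

Lemma matching_ofP m x y : involutive m -> y != x ->
  reflect (y = m x) ([set x; y] \in matching_of m).
Proof.
move=> mK yx; apply: (iffP imsetP) => [[z _ xy]|->]; last by exists x.
have : x \in [set z; m z] by rewrite -xy !inE eqxx.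
rewrite !inE => /orP[]/eqP xz; move: xy; first by rewrite -xz => /set2_inj->.
by rewrite (canRL mK (esym xz)) mK [RHS]setUC => /set2_inj->.
Qed.

(* In a union of two perfect matchings, [n \o m] moves two steps along the
   cycle through [x], so it never meets the vertices at odd distance. *)
Lemma iter_neq_partner m n i x : involutive m -> involutive n ->
  (forall y, m y != y) -> (forall y, n y != y) -> m (iter i (n \o m) x) != x.
Proof.
move=> mK nK m_neq n_neq.
elim: {i}_.+1 {-2}i x (ltnSn i) => // k IHk [|[|i]] x ik; first exact: m_neq.
  by rewrite /= (inv_eq mK) n_neq.
(* Moving the outer [m] and [n] to the other side leaves the same claim at [n (m x)] with two fewer
   iterations. *)
rewrite iterS iterSr /= (inv_eq mK) (inv_eq nK); apply: IHk.
by rewrite -ltnS ltnW.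
Qed.

(** The orbit [O] and its [m]-image are disjoint by [iter_neq_partner]. Their union is closed under
    [m] and [n], so by connectivity it is everything. *)
Lemma linked_bipartite m n x0 : involutive m -> involutive n ->
  (forall x, m x != x) -> (forall x, n x != x) ->
  (forall x y, connect (linked m n) x y) ->
  forall x, let O := fconnect (n \o m) x0 in
    (O (m x) = ~~ O x) * (O (n x) = ~~ O x).
Proof.
move=> mK nK m_neq n_neq conn x O.
have fsym : connect_sym (frel (n \o m)).
  by apply: fconnect_sym; apply: inj_comp; apply: inv_inj.
have Of z : O (n (m z)) = O z.
  apply/idP/idP => [Oz|Oz]; last by apply: connect_trans Oz (fconnect1 _ _).
  by apply: connect_trans Oz _; rewrite fsym; apply: (fconnect1 (n \o m)).
have mO z : O z -> ~~ O (m z).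
  move=> Oz; apply/negP=> Omz.
  have /iter_findex : fconnect (n \o m) (m z) z.
    by apply: connect_trans Oz; rewrite fsym.
  move/(congr1 m)/eqP; apply/negP; exact: iter_neq_partner.
have Oor z : O z || O (m z).
  have /closed_connect : closed (linked m n) [pred z | O z || O (m z)].
    apply: intro_closed; first exact/sym_connect_sym/linked_sym.
    move=> y {}z /= /orP[]/eqP->; rewrite !inE; first by rewrite mK orbC.
    have -> : O (n y) = O (m y) by rewrite -[RHS]Of mK.
    have -> : O (m (n y)) = O y by rewrite -[LHS]Of mK nK.
    by rewrite orbC.
  by move=> /(_ x0 z (conn _ _)); rewrite !inE /O connect0.
have mE z : O (m z) = ~~ O z.
  by apply/idP/idP => [/mO|/negPf Oz]; [rewrite mK | move: (Oor z); rewrite Oz].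
by split=> //; rewrite -{1}[x]mK Of mE.
Qed.

(** For the converse, the bipartition orients the union: [m]-edges leave [O] and [n]-edges return to
    it, so following the arrows walks round the cycle. *)
Lemma hamiltonian_linked m n : involutive m -> involutive n ->
  (forall x, m x != x) -> (forall x, n x != x) ->
  @hamiltonian_cycle (complete_graph T) (matching_of m :|: matching_of n) <->
  2 < #|T| /\ forall x y, connect (linked m n) x y.
Proof.
move=> mK nK m_neq n_neq; split=> [[c [c_gt2 /andP[cc uc] allc defC]]|[T_gt2 conn]].
  split; first by rewrite (leq_trans c_gt2) // -(card_uniqP uc) max_card.
  move=> x y; apply: (@connect_cycle _ _ c) => //.
  apply: sub_in_cycle (cycle_next uc); last by apply/allP => z _; exact: allc.
  move=> {y}x _ _ _ /eqP<-.
  have cx : next c x != x by rewrite eq_sym; exact: (next_cycle cc (allc x)).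
  have : [set x; next c x] \in matching_of m :|: matching_of n.
    by rewrite defC; apply: imset_f.
  by case/setUP=> [/(matching_ofP mK cx)|/(matching_ofP nK cx)] /= ->;
    rewrite eqxx ?orbT.
have [x0 _] : exists x0 : T, x0 \in T by apply/card_gt0P; apply: leq_trans T_gt2.
pose O := fconnect (n \o m) x0.
have OE x : (O (m x) = ~~ O x) * (O (n x) = ~~ O x) by exact: linked_bipartite.
(* [g \o g] agrees with [n \o m] on [O], so the [g]-orbit of [x0] covers [T]. *)
pose g x := if O x then m x else n x.
have Og x : O (g x) = ~~ O x by rewrite /g; case: ifP => Ox; rewrite OE Ox.
have g_inj : injective g.
  move=> x y gxy; have := congr1 O gxy; rewrite !Og => /negb_inj Oxy.
  by move: gxy; rewrite /g Oxy; case: ifP => _; exact: inv_inj.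
have gO x : O x -> fconnect g x0 x.
  move=> /iter_findex<-; elim: (findex _ _ _) => [|i IHi]; first exact: connect0.
  have Oi : O (iter i (n \o m) x0) by apply: fconnect_iter.
  have -> : iter i.+1 (n \o m) x0 = g (g (iter i (n \o m) x0)).
    by rewrite {2}/g Oi /g OE Oi.
  apply: connect_trans (fconnect1 g _); exact: connect_trans (fconnect1 g _).
have gall x : x \in orbit g x0.
  rewrite -fconnect_orbit; have [/gO//|Ox] := boolP (O x).
  have Omx : O (m x) by rewrite OE.
  have -> : x = g (m x) by rewrite /g Omx mK.
  exact: connect_trans (gO _ Omx) (fconnect1 g _).
have next_g x : next (orbit g x0) x = g x.
  by have /eqP := next_cycle (cycle_orbit g_inj x0) (gall x).
exists (orbit g x0); split=> //.
- by rewrite -(card_uniqP (orbit_uniq g x0)) (eq_card (gall : _ =i T)).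
- rewrite /ucycle orbit_uniq andbT; apply: sub_cycle (cycle_orbit g_inj x0).
  move=> x _ /eqP<-; rewrite /= /complete_adj eq_sym /g; by case: ifP.
apply/setP=> A; rewrite inE; apply/orP/imsetP.
  (* An [m]-edge is traversed from its end in [O], an [n]-edge from its end outside [O]. *)
  case=> /imsetP[x _ ->]; case Ox: (O x).
  - by exists x; rewrite ?gall // next_g /g Ox.
  - by exists (m x); rewrite ?gall // next_g /g OE Ox mK setUC.
  - by exists (n x); rewrite ?gall // next_g /g OE Ox nK setUC.
  - by exists x; rewrite ?gall // next_g /g Ox.
case=> x _ ->; rewrite next_g /g; case: ifP => _; [left | right]; exact: imset_f.
Qed.

End Matchings.

(** * The PH-property restated for involutions *)

Lemma exists_matching_partner (G : sgraph) (M : {set {set G}}) :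
  perfect_matching M ->
  exists m : G -> G,
    [/\ involutive m, forall x, adj x (m x) & M = [set [set x; m x] | x : G]].
Proof.
case/andP=> /subsetP sME /and3P[/eqP covM trivM M0].
have cov x : x \in cover M by rewrite covM.
have /fin_all_exists[m mP] x : exists y, adj x y /\ pblock M x = [set x; y].
  have /imsetP[[a b] /=] := sME _ (pblock_mem (cov x)); rewrite inE /= => ab defB.
  move: (cov x); rewrite -mem_pblock defB !inE => /orP[]/eqP->; first by exists b.
  by exists a; rewrite adj_sym setUC.
have mK : involutive m.
  move=> x; apply: esym; apply: (@set2_inj _ (m x)).
    by apply: contraTneq (mP x).1 => {1}->; rewrite adj_irrefl.
  rewrite -(mP (m x)).2 setUC -(mP x).2; apply/esym.
  by apply: def_pblock; rewrite ?pblock_mem // (mP x).2 !inE eqxx orbT.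
exists m; split=> // [x|]; first by have [] := mP x.
apply/setP=> B; apply/idP/imsetP => [MB|[x _ ->]].
  have [B0|[x Bx]] := set_0Vmem B; first by rewrite -B0 MB in M0.
  by exists x; rewrite // -(mP x).2 (def_pblock _ MB).
by rewrite -(mP x).2 pblock_mem.
Qed.

Lemma matching_of_perfect (G : sgraph) (m : G -> G) :
  involutive m -> (forall x, adj x (m x)) ->
  perfect_matching ([set [set x; m x] | x : G] : {set {set G}}).
Proof.
move=> mK adjm; apply/andP; split.
  apply/subsetP=> _ /imsetP[x _ ->]; apply/imsetP.
  by exists (x, m x); rewrite ?inE.
apply/and3P; split.
- apply/eqP/setP=> x; rewrite !inE; apply/bigcupP.
  by exists [set x; m x]; [exact: imset_f | rewrite !inE eqxx].
- apply/trivIsetP=> _ _ /imsetP[x _ ->] /imsetP[y _ ->]; apply: contraNT.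
  case/pred0Pn=> z; rewrite !inE => /andP[/orP zx /orP zy].
  have zE w : z == w \/ z == m w -> [set w; m w] = [set z; m z].
    by case=> /eqP->//; rewrite mK setUC.
  by rewrite (zE x zx) (zE y zy).
by apply/imsetP=> -[x _ /setP/(_ x)]; rewrite !inE eqxx.
Qed.

Lemma adj_neq (G : sgraph) (n : G -> G) :
  (forall x, adj x (n x)) -> forall x, n x != x.
Proof.
by move=> adjn x; apply: contraTneq (adjn x) => ->; rewrite adj_irrefl.
Qed.

Definition linkable (G : sgraph) (m : G -> G) : Prop :=
  exists n : G -> G, [/\ involutive n, forall x, adj x (n x), 2 < #|G|
    & forall x y, connect (linked m n) x y].

Lemma PH_property_linked (G : sgraph) :
  PH_property G <-> ~~ odd #|G| /\
    forall m : G -> G, involutive m -> (forall x, m x != x) -> linkable m.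
Proof.
split=> -[evG PH]; split=> //; [move=> m mK m_neq | move=> M].
  have adjm x : @adj (complete_graph G) x (m x) by rewrite /= /complete_adj eq_sym.
  have [N [/exists_matching_partner[n [nK adjn ->]]]] :=
    PH _ (@matching_of_perfect (complete_graph G) m mK adjm).
  case/(hamiltonian_linked mK nK m_neq (adj_neq adjn)) => G_gt2 conn.
  by exists n.
case/exists_matching_partner => m [mK adjm ->].
have m_neq (x : G) : m x != x by rewrite eq_sym; exact: adjm.
have [n [nK adjn G_gt2 conn]] := PH m mK m_neq.
exists (matching_of n); split; first exact: matching_of_perfect.
by apply/(hamiltonian_linked mK nK m_neq (adj_neq adjn)).
Qed.

(** * Extending pairings of the prism *)

Lemma connect_layers (T : finType) (e : rel (T * bool)) : symmetric e ->
  (forall x y, connect e (x, true) (y, true)) ->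
  (forall x, exists y, connect e (x, false) (y, true)) ->
  forall u v, connect e u v.
Proof.
move=> /sym_connect_sym e_sym e_top e_down.
have up u : exists y, connect e u (y, true).
  by case: u => x []; [exists x; exact: connect0 | exact: e_down].
move=> u v; have [x ux] := up u; have [y vy] := up v.
by apply: connect_trans ux (connect_trans (e_top x y) _); rewrite e_sym.
Qed.

Lemma prism_card_gt2 (G : sgraph) : 2 < #|G| -> 2 < #|prism G|.
Proof. by move/leq_trans; apply; rewrite card_prod card_bool leq_pmulr. Qed.

Lemma prism_pairing_uncrossed (G : sgraph) (m : prism G -> prism G) :
  (forall p : G -> G, involutive p -> (forall x, p x != x) -> linkable p) ->
  involutive m -> (forall u, m u != u) -> (forall u, (m u).2 = u.2) ->
  linkable m.
Proof.
move=> PH mK m_neq m2; pose p b (x : G) := (m (x, b)).1.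
have mE x b : m (x, b) = (p b x, b) by rewrite [LHS]surjective_pairing m2.
have pK b : involutive (p b).
  by move=> x; rewrite {1}/p -mE mK.
have p_neq b x : p b x != x.
  by apply: contraNneq (m_neq (x, b)) => px; rewrite mE px.
have [n [nK adjn G_gt2 conn]] := PH _ (pK true) (p_neq true).
have n_neq := adj_neq adjn.
pose e := linked (p false) n.
have e_sym : connect_sym e by apply/sym_connect_sym/linked_sym.
have root_n x : root e (n x) = root e x.
  by apply/(rootP e_sym); rewrite e_sym; exact: connect_linkedr.
(* Both ends of one [n]-edge per component of [e], namely the edge at its root. *)
pose S := [set x | (x == root e x) || (n x == root e x)].
have nS x : (n x \in S) = (x \in S) by rewrite !inE root_n nK orbC.
have sub_e x y : connect (cut S (p false) n) x y -> connect e x y.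
  apply: connect_sub => {}x {}y /orP[/eqP->|/andP[_ /eqP->]].
    exact: connect_linkedl.
  exact: connect_linkedr.
(* [S] meets each component of [e] in a single pair [x], [n x]; by parity, no
   component of the cut graph contains just one of the two. *)
have S_conn x : x \in S -> connect (cut S (p false) n) x (n x).
  move=> Sx; have := cut_component_even (pK false) (p_neq false) nK n_neq nS x.
  apply: contraR => xnx.
  suff -> : [set y in S | connect (cut S (p false) n) x y] = [set x].
    by rewrite cards1.
  apply/setP=> y; rewrite in_set1 inE; apply/andP/eqP => [[Sy xy]|->//].
  have /(rootP e_sym) rxy := sub_e _ _ xy.
  have nyx : n x != y by apply: contraNneq xnx => ->.
  move: Sx Sy; rewrite !inE -rxy => /orP[]/eqP rx /orP[]/eqP ry.
  - by rewrite rx ry.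
  - by move: nyx; rewrite (inv_eq nK) {1}rx -ry eqxx.
  - by rewrite ry rx eqxx in nyx.
  - by apply: (inv_inj nK); rewrite rx ry.
pose N (u : prism G) : prism G := if u.1 \in S then (u.1, ~~ u.2) else (n u.1, u.2).
have NK : involutive N.
  case=> x b; rewrite [N (x, b)]/N /=.
  by case: ifP => Sx; rewrite /N /= ?nS Sx ?negbK ?nK.
have N_S x b : x \in S -> connect (linked m N) (x, b) (x, ~~ b).
  by move=> Sx; have := connect_linkedr m N (x, b); rewrite {2}/N /= Sx.
have N_S' x b : x \notin S -> connect (linked m N) (x, b) (n x, b).
  by move=> Sx; have := connect_linkedr m N (x, b); rewrite {2}/N /= (negPf Sx).
have low x y : connect (cut S (p false) n) x y ->
    connect (linked m N) (x, false) (y, false).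
  apply: (connect_homo (f := pair^~ false)) => {}x {}y.
  case/orP=> [/eqP->|/andP[Sx /eqP->]]; last exact: N_S'.
  rewrite -mE; exact: connect_linkedl.
exists N; split=> [//|[x b]||].
- rewrite /N /= /box_adj /=; case: ifP => _ /=; rewrite eqxx /=.
    by rewrite /complete_adj; case: b.
  by rewrite adjn orbT.
- exact: prism_card_gt2.
apply: connect_layers => [|x y|x]; first exact: linked_sym.
  apply: (connect_homo (f := pair^~ true)) (conn x y) => {}x {}y.
  case/orP=> /eqP->; first by rewrite -mE; exact: connect_linkedl.
  (* A selected [n]-edge of the upper copy is replaced by going down at [x], following the lower cut
     path to [n x], and coming up there. *)
  have [Sx|] := boolP (x \in S); last exact: N_S'.
  apply: connect_trans (N_S _ _ Sx) _; apply: connect_trans (low _ _ (S_conn _ Sx)) _.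
  by apply: N_S; rewrite nS.
have Sr : root e x \in S by rewrite inE root_root ?eqxx.
have [v Sv xv] := cut_reach (pK false) nK Sr (connect_root e x).
by exists v; apply: connect_trans (low _ _ xv) (N_S _ _ Sv).
Qed.

Lemma prism_pairing_crossed (G : sgraph) (m : prism G -> prism G) u0 :
  ~~ odd #|G| ->
  (forall p : G -> G, involutive p -> (forall x, p x != x) -> linkable p) ->
  involutive m -> (forall u, m u != u) -> (m u0).2 != u0.2 ->
  linkable m.
Proof.
move=> evG PH mK m_neq m2.
(* On [X b], [p b] is the bijection onto [X (~~ b)] given by the crossing edges; off [X b] it pairs
   the complement. *)
pose X b : {set G} := [set x | (m (x, b)).2 != b]; pose p b (x : G) := (m (x, b)).1.
have mX x b : x \in X b -> m (x, b) = (p b x, ~~ b).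
  by rewrite inE negb_eqb [LHS]surjective_pairing => /addbP/(canRL negbK)->.
have mX' x b : x \notin X b -> m (x, b) = (p b x, b).
  by rewrite inE negbK [LHS]surjective_pairing => /eqP->.
have pX x b : x \in X b -> p b x \in X (~~ b) /\ p (~~ b) (p b x) = x.
  move=> /mX mx; split; last by rewrite {1}/p -mx mK.
  by rewrite inE -mx mK /=; case: b {mx}.
have pX' b : pairs (p b) (~: X b).
  move=> x; rewrite inE => /mX' mx; split.
  - by rewrite !inE negbK -mx mK.
  - by apply: contraNneq (m_neq (x, b)) => px; rewrite mx px.
  by rewrite {1}/p -mx mK.
(* This vertex is the target that lets [cut_reach] lead every lower vertex to a crossing edge. *)
have [u Xu] : exists u, u \in X false.
  case: u0 m2 => x [] /= mx; last by exists x; rewrite inE.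
  have Xx : x \in X true by rewrite inE.
  by exists (p true x); have [] := pX _ _ Xx.
have [q qX] : exists q, pairs q (X false).
  apply: even_pairs; move: evG; rewrite -(cardsC (X false)) oddD.
  by rewrite (negPf (pairs_even (pX' false))) addbF.
have [p1K p1_neq p1X] := patch_pairs qX (pX' false).
set p1 := (fun x => _) in p1K p1_neq p1X.
have [n1 [n1K adjn1 G_gt2 conn1]] := PH p1 p1K p1_neq.
(* Since [p1] is [q] on [X false], the edges deleted are exactly the added ones. *)
pose e := cut (X false) n1 p1.
have e_sym : connect_sym e by exact: cut_connect_sym.
have /fin_all_exists[P PX] x : exists h, pairs h [set y in X false | connect e x y].
  by apply: even_pairs; apply: cut_component_even => //; apply: adj_neq.
(* Choosing the pairing by the root gives all vertices of a component the same one, which makes [r]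
   involutive on [X false]. *)
pose r x := P (root e x) x.
have rP x : x \in X false -> connect e x (r x) /\
    [/\ r x \in X false, r x != x & r (r x) = x].
  move=> Xx; have [|] := PX (root e x) x; first by rewrite inE Xx e_sym connect_root.
  rewrite inE -/(r x) => /andP[Xrx rx] rx_x rrx.
  have xrx : connect e x (r x) by apply: connect_trans (connect_root e x) rx.
  by split=> //; split=> //; rewrite {1}/r -(rootP e_sym xrx).
pose q2 x := p false (r (p true x)).
have q2X : pairs q2 (X true).
  move=> x Xx; have [Xpx ppx] := pX _ _ Xx.
  have [_ [Xrpx rpx_neq rrpx]] := rP _ Xpx; have [Xq2 pq2] := pX _ _ Xrpx.
  split=> //; first by apply: contraNneq rpx_neq => {2}<-; rewrite pq2.
  by rewrite {1}/q2 pq2 rrpx ppx.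
have [p2K p2_neq _] := patch_pairs q2X (pX' true).
set p2 := (fun x => _) in p2K p2_neq.
have [n2 [n2K adjn2 _ conn2]] := PH p2 p2K p2_neq.
pose N (u : prism G) : prism G := ((if u.2 then n2 else n1) u.1, u.2).
have NK : involutive N by case=> x []; rewrite /N /= ?n1K ?n2K.
have low x y : connect e x y -> connect (linked m N) (x, false) (y, false).
  apply: (connect_homo (f := pair^~ false)) => {}x {}y.
  case/orP=> [/eqP->|/andP[Xx /eqP->]]; first exact: (connect_linkedr m N (x, false)).
  rewrite /p1 (negPf Xx) -mX' //; exact: connect_linkedl.
have m_up x : x \in X false -> connect (linked m N) (x, false) (p false x, true).
  by move/mX=> /= <-; exact: connect_linkedl.
exists N; split=> [//|[x b]||].
- by rewrite /= /box_adj /= eqxx; case: b; rewrite ?adjn1 ?adjn2 orbT.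
- exact: prism_card_gt2.
apply: connect_layers => [|x y|x]; first exact: linked_sym.
  apply: (connect_homo (f := pair^~ true)) (conn2 x y) => {}x {}y.
  case/orP=> /eqP->; last exact: (connect_linkedr m N (x, true)).
  rewrite /p2; case: ifPn => Xx; last by rewrite -mX' //; exact: connect_linkedl.
  (* A [q2]-edge becomes a detour: cross down to [p true x], follow the cut path to its [r]-partner,
     and cross up. *)
  have [Xpx _] := pX _ _ Xx; have [xrx [Xrx _ _]] := rP _ Xpx.
  apply: connect_trans (connect_trans (low _ _ xrx) (m_up _ Xrx)).
  rewrite -[(p true x, false)](mX _ _ Xx); exact: connect_linkedl.
have [|v Xv xv] := cut_reach n1K p1K Xu (x := x); first by rewrite connect_linkedC.
by exists (p false v); apply: connect_trans (low _ _ xv) (m_up _ Xv).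
Qed.

Lemma prism_PH (G : sgraph) : PH_property G -> PH_property (prism G).
Proof.
case/PH_property_linked=> evG PH; apply/PH_property_linked; split=> [|m mK m_neq].
  by rewrite card_prod card_bool muln2 odd_double.
have [/forallP m2|/forallPn[u m2]] := boolP [forall u, (m u).2 == u.2].
  by apply: prism_pairing_uncrossed => // u; apply/eqP.
exact: prism_pairing_crossed m2.
Qed.

Theorem theorem2p1 (G : sgraph) (hG : PH_property G) (k : nat) :
  PH_property (iter k prism G).
Proof. by elim: k => //= k; exact: prism_PH. Qed.
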